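(* Let $S\in\mathcal{S}^d_m$, $G\in\mathcal{M}(S)$, $j\in\{1,\dots,d\}$, and assume that $D:=\operatorname{int}\operatorname{dom}\psi_G\ne\emptyset$. For every $n\ge1$, there exist a compact set $C_n\subset G-G$ and a function $h_n\in\mathcal{H}^j_{\theta^j(C_n)}$ such that $$\Sigma^j(\overline{\partial}^S\psi_G)\subset\Sigma^j(P_G)\subset\bigcup_{n}\{x\in\mathbb{R}^d:\ h_n(Sx)=0\}.$$ For any $\epsilon>0$, all $C_n$ can be chosen such that $\operatorname{diam}\theta^j(C_n)<\epsilon$.
   Context: $\mathcal{S}^d_m$ is the set of invertible symmetric real $d\times d$ matrices with exactly $m\in\{0,1,\dots,d\}$ positive eigenvalues. For $S\in\mathcal{S}^d_m$, $S(x,y)=\langle x,Sy\rangle$ for $x,y\in\mathbb{R}^d$. $\mathcal{M}(S)$ is the family of closed non-empty $S$-monotone sets $G\subset\mathbb{R}^d$, i.e. $S(x-y,x-y)\ge0$ for all $x,y\in G$. For such $G$, and $x\in\mathbb{R}^d$, $$\psi_G(x)=\sup_{y\in G}\Big(S(x,y)-\tfrac12S(y,y)\Big)\in\mathbb{R}\cup\{+\infty\},\qquad P_G(x)=\operatorname*{arg\,min}_{y\in G}S(x-y,x-y)$$ (the possibly empty set of minimizers), and $\operatorname{dom}\psi_G=\{x:\psi_G(x)<\infty\}$; $\psi_G$ is a convex lower semicontinuous function. With $\operatorname{dom}\nabla\psi_G=\{x\in D:\psi_G\text{ is differentiable at }x\}$, the Clarke-type subdifferential is $\overline{\partial}\psi_G(x)=\operatorname{cl}\operatorname{conv}\{\lim_n\nabla\psi_G(x_n):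 x_n\in\operatorname{dom}\nabla\psi_G,\ x_n\to x\}$ for $x\in\operatorname{cl}D$ (over all sequences for which the limit of gradients exists), and $\emptyset$ for $x\notin\operatorname{cl}D$; and $\overline{\partial}^S\psi_G(x)=S^{-1}\,\overline{\partial}\psi_G(x)$. For a set-valued map $\Psi$ on $\mathbb{R}^d$ with values in closed subsets of $\mathbb{R}^d$, $\Sigma^j(\Psi)=\{x\in\mathbb{R}^d:\exists\,y_1,y_2\in\Psi(x)\text{ with }y_1^j\ne y_2^j\}$. $G-G=\{a-b:a,b\in G\}$; $\operatorname{diam}E=\sup_{x,y\in E}|x-y|$ (Euclidean norm). $x^j$ is the $j$th coordinate of $x\in\mathbb{R}^d$ and $x^{-j}\in\mathbb{R}^{d-1}$ is $x$ with its $j$th coordinate removed. For a compact set $C\subset\{x\in\mathbb{R}^d: x^j>0\}$, $\theta^j(C)=\{y/y^j: y\in C\}$, a compact set all of whose elements have $j$th coordinate $1$ (so the notation $\theta^j(C_n)$ presupposes $x^j>0$ for all $x\in C_n$). For a compact set $C$ all of whose elements have $j$th coordinate equal to $1$, $\mathcal{H}^j_C$ is the family of functions $h$ on $\mathbb{R}^d$ of the form $$h(x)=x^j+g_1(x^{-j})-g_2(x^{-j}),$$ where $g_1,g_2:\mathbb{R}^{d-1}\to\mathbb{R}$ are convex, have linear growth ($|g_i(u)|\le K(1+|u|)$ for some constant $K>0$ and all $u$), and $\nabla h(x)\in C$ whenever both $g_1$ and $g_2$ are differentiable at $x^{-j}$.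
   Formalization: If all points of G have the same j-th coordinate (e.g. G a singleton), no admissible C_n, h_n exist, since C_n must be empty and the family for the empty set is empty; in that case the union over n is taken to be empty, so both singular sets are asserted to be empty. *)

(* Defs.v *)
From HB Require Import structures.
From mathcomp Require Import all_boot all_order all_algebra.
From mathcomp Require Import all_classical all_reals all_analysis.

Set Implicit Arguments.
Unset Strict Implicit.
Unset Printing Implicit Defensive.

Import Order.TTheory GRing.Theory Num.Theory.
Import numFieldNormedType.Exports.

Local Open Scope classical_set_scope.
Local Open Scope ring_scope.

Section Euclidean.
Context {R : realType} {d : nat}.
Implicit Types (x y : 'cV[R]_d) (f : 'cV[R]_d -> R) (A E : set 'cV[R]_d).

Definition dot x y : R := \sum_(i < d) x i 0 * y i 0.

(* The norm that the library puts on matrices is the sup norm: it induces the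
   same topology, but not the same diameters. *)
Definition enorm x : R := Num.sqrt (dot x x).

(* In [\bar R], since [E] may be unbounded. *)
Definition diam E : \bar R :=
  ereal_sup [set (enorm (x - y))%:E | x in E & y in E].

(* Only meaningful at the points where [f] is differentiable. *)
Definition gradient f x : 'cV[R]_d := \col_(i < d) 'D_(delta_mx i 0) f x.

Definition convex_hull A : set 'cV[R]_d :=
  smallest (@convex_set R 'cV[R]_d) A.

Definition minkowski_diff A E : set 'cV[R]_d := [set a - b | a in A & b in E].

End Euclidean.

Section MonotoneSets.
Context {R : realType} {d : nat}.
Implicit Types (S : 'M[R]_d) (x y : 'cV[R]_d) (G : set 'cV[R]_d).

(* The eigenvalues are counted with multiplicity: [s] lists the roots of the
   characteristic polynomial. *)
Definition symmetric_signature (m : nat) S : Prop :=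
  [/\ S^T = S, S \in unitmx &
      exists s : seq R, char_poly S = \prod_(a <- s) ('X - a%:P) /\
                        count (fun a => 0 < a) s = m].

Definition sprod S x y : R := dot x (S *m y).

Definition monotone_family S G : Prop :=
  [/\ closed G, G !=set0 &
      forall x y, G x -> G y -> 0 <= sprod S (x - y) (x - y)].

Definition psi S G x : \bar R :=
  ereal_sup [set (sprod S x y - 2^-1 * sprod S y y)%:E | y in G].

Definition nearest S G x : set 'cV[R]_d :=
  [set y | G y /\
     forall z, G z -> sprod S (x - y) (x - y) <= sprod S (x - z) (x - z)].

End MonotoneSets.

Section Subdifferential.
Context {R : realType} {d : nat}.
Implicit Types (f : 'cV[R]_d -> \bar R) (x : 'cV[R]_d).

Definition edom f : set 'cV[R]_d := [set x | (f x < +oo)%E].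

(* Near a point of the interior of the domain, [fine \o f] is [f] itself when
   [f] does not take the value [-oo], as is the case of [psi S G]. *)
Definition dom_gradient f : set 'cV[R]_d :=
  [set x | interior (edom f) x /\ differentiable (fine \o f) x].

Definition limiting_gradients f x : set 'cV[R]_d :=
  [set v | exists u : nat -> 'cV[R]_d,
     [/\ forall n, dom_gradient f (u n),
         u n @[n --> \oo] --> x &
         gradient (fine \o f) (u n) @[n --> \oo] --> v]].

Definition clarke f x : set 'cV[R]_d :=
  [set v | closure (interior (edom f)) x /\
           closure (convex_hull (limiting_gradients f x)) v].

Definition sclarke (S : 'M[R]_d) f x : set 'cV[R]_d :=
  [set invmx S *m v | v in clarke f x].

End Subdifferential.

Section Singularities.
Context {R : realType} {d : nat}.
Implicit Types (j : 'I_d) (x : 'cV[R]_d) (C G : set 'cV[R]_d).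

Definition Sigma j (Psi : 'cV[R]_d -> set 'cV[R]_d) : set 'cV[R]_d :=
  [set x | exists y1 y2, [/\ Psi x y1, Psi x y2 & y1 j 0 != y2 j 0]].

Definition theta j C : set 'cV[R]_d := [set (y j 0)^-1 *: y | y in C].

Definition linear_growth (n : nat) (g : 'cV[R]_n -> R) : Prop :=
  exists K : R, 0 < K /\ forall u, `|g u| <= K * (1 + enorm u).

(* [row' j x] is the vector [x] with its [j]-th coordinate removed. *)
Definition dc_family j C (h : 'cV[R]_d -> R) : Prop :=
  exists g1 g2 : 'cV[R]_d.-1 -> R,
    [/\ convex_function setT g1 /\ linear_growth g1,
        convex_function setT g2 /\ linear_growth g2,
        forall x, h x = x j 0 + g1 (row' j x) - g2 (row' j x) &
        forall x, differentiable g1 (row' j x) ->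
                  differentiable g2 (row' j x) -> C (gradient h x)].

(* The integers n >= 1, except that the family is empty when all the points of
   [G] have the same [j]-th coordinate. In that case [minkowski_diff G G] has no
   point with a positive [j]-th coordinate, and no function belongs to
   [dc_family j set0], because convex functions are differentiable almost
   everywhere; the union over [indices j G] is then empty. *)
Definition indices j G : set nat :=
  [set n | (1 <= n)%N /\
           exists y1 y2, [/\ G y1, G y2 & y1 j 0 != y2 j 0]].

Definition admissible j G C (h : 'cV[R]_d -> R) : Prop :=
  [/\ compact C, C `<=` minkowski_diff G G,
      forall x, C x -> 0 < x j 0 & dc_family j (theta j C) h].

End Singularities.

(* Main.v *)
Require Import Defs.
From mathcomp Require Import all_boot all_order all_algebra.
From mathcomp Require Import all_classical all_reals all_analysis.
From mathcomp Require Import ring lra.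
Import Order.TTheory GRing.Theory Num.Theory.
Import numFieldNormedType.Exports.
Local Open Scope classical_set_scope.
Local Open Scope ring_scope.

(* Put p = S x, so that a nearest point of G to x is a maximizer over y of
   <p, y> - S(y, y) / 2.

   If psi is differentiable at x, near-maximizers y satisfy S y ~ grad psi (x),
   hence converge to a nearest point; nearest points have closed graph, so the
   limiting gradients at x are S-images of nearest points, and convex hulls and
   closures preserve the equality of the j-th coordinates.

   Let C1, C2 be compact subsets of G with y^j <= a < b <= y'^j for y in C1 and
   y' in C2, and let phi1, phi2 be the maxima over C1, C2 of the above affine
   functions of p. If x has nearest points in both sets, phi1 = phi2 at p = S x.
   Write p = (t, u) with t = p^j. As phi1 - a t is nonincreasing and phi2 - b t
   is nondecreasing in t, there is a single zero tau u of phi2 - phi1 on each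
   line. For c in [a, b] the function
     w_c u = min over t of max (phi1 - c t, phi2 - c t)
           = phi1 (tau u, u) - c * tau u
   is convex, as the partial minimum of a jointly convex function, and
   - tau = (w_b - w_a) / (b - a) is the required difference of convex functions.
   With maximizers y1, y2 at (tau u, u), stationarity gives
   grad (t - tau u) = (y2 - y1) / (y2 - y1)^j.

   Finally, countably many pairs of small rational boxes cover all pairs of
   points of G with distinct j-th coordinates. *)

Set Implicit Arguments.
Unset Strict Implicit.
Unset Printing Implicit Defensive.

(** * The Euclidean inner product and entrywise convergence *)

Section Dot.
Context {R : realType} {d : nat}.
Implicit Types (x y z : 'cV[R]_d) (S : 'M[R]_d).

Lemma dotE x y : dot x y = (x^T *m y) 0 0.
Proof. by rewrite mxE; apply: eq_bigr => i _; rewrite mxE. Qed.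

Lemma dotC x y : dot x y = dot y x.
Proof. by apply: eq_bigr => i _; rewrite mulrC. Qed.

Lemma dotDr x y z : dot x (y + z) = dot x y + dot x z.
Proof. by rewrite !dotE mulmxDr mxE. Qed.

Lemma dotZr a x y : dot x (a *: y) = a * dot x y.
Proof. by rewrite !dotE -scalemxAr mxE. Qed.

Lemma dotBr x y z : dot x (y - z) = dot x y - dot x z.
Proof. by rewrite -scaleN1r dotDr dotZr mulN1r. Qed.

Lemma dot0r x : dot x 0 = 0.
Proof. by rewrite -(subrr 0) dotBr subrr. Qed.

Lemma dotDl x y z : dot (x + y) z = dot x z + dot y z.
Proof. by rewrite !(dotC _ z) dotDr. Qed.

Lemma dotZl a x y : dot (a *: x) y = a * dot x y.
Proof. by rewrite !(dotC _ y) dotZr. Qed.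

Lemma dotBl x y z : dot (x - y) z = dot x z - dot y z.
Proof. by rewrite !(dotC _ z) dotBr. Qed.

Lemma dot_delta i x : dot (delta_mx i 0) x = x i 0.
Proof.
rewrite /dot (bigD1 i)//= mxE !eqxx mul1r big1 ?addr0// => k ki.
by rewrite mxE (negbTE ki) mul0r.
Qed.

Lemma dot_ge0 x : 0 <= dot x x.
Proof. by apply: sumr_ge0 => i _; rewrite -expr2 sqr_ge0. Qed.

(** Parallelogram law, with the nonnegative square of [x + y] dropped. *)
Lemma dot_sub_le x y : dot (x - y) (x - y) <= 2 * dot x x + 2 * dot y y.
Proof.
have := dot_ge0 (x + y); rewrite !dotBl !dotBr !dotDl !dotDr; lra.
Qed.

Lemma dot_mulmx_sym S x y : S^T = S -> dot x (S *m y) = dot (S *m x) y.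
Proof. by move=> Ssym; rewrite !dotE trmx_mul Ssym mulmxA. Qed.

Lemma cvg_mx_entry m n (T : Type) (F : set_system T) {FF : Filter F}
    (f : T -> 'M[R]_(m, n)) (A : 'M[R]_(m, n)) i j :
  f @ F --> A -> (fun t => f t i j) @ F --> A i j.
Proof. move=> fA; exact: (cvg_comp _ _ fA (@coord_continuous R m n i j A)). Qed.

Lemma dot_cvg (T : Type) (F : set_system T) {FF : Filter F}
    (f g : T -> 'cV[R]_d) x y :
  f @ F --> x -> g @ F --> y -> (fun t => dot (f t) (g t)) @ F --> dot x y.
Proof.
move=> fx gy; apply: cvg_big; first exact: add_continuous.
by move=> i _; apply: cvgM; exact: cvg_mx_entry.
Qed.

Lemma cvg_coord m n (T : Type) (F : set_system T) {FF : Filter F}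
    (f : T -> 'M[R]_(m, n)) (A : 'M[R]_(m, n)) :
  (forall i j, (fun t => f t i j) @ F --> A i j) -> f @ F --> A.
Proof.
move=> fA B [P PA PB].
have : \forall t \near F, forall ij : 'I_m * 'I_n, P ij.1 ij.2 (f t ij.1 ij.2).
  by apply: filter_forall => -[i j]; exact: fA (PA i j).
by apply: filterS => t ft; apply: PB => i j; exact: (ft (i, j)).
Qed.

Lemma mulmx_cvg m n p (A : 'M[R]_(m, n)) (T : Type) (F : set_system T)
    {FF : Filter F} (f : T -> 'M[R]_(n, p)) (B : 'M[R]_(n, p)) :
  f @ F --> B -> (fun t => A *m f t) @ F --> A *m B.
Proof.
move=> fB; apply: cvg_coord => i j.
under eq_fun do rewrite mxE.
rewrite mxE; apply: cvg_big; first exact: add_continuous.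
move=> k _; apply: cvgM; first exact: cvg_cst.
exact: cvg_mx_entry.
Qed.

End Dot.

(** * Nearest points as maximizers, and limits of gradients of psi *)

Section Nearest.
Context {R : realType} {d : nat}.
Implicit Types (x y z : 'cV[R]_d) (S : 'M[R]_d) (G : set 'cV[R]_d).

Definition score S x y : R := sprod S x y - 2^-1 * sprod S y y.

(** Expanding the square, S(x - z, x - z) is S(x, x) minus twice the score of z, and the first term
    does not depend on z. *)
Lemma nearestP S G x y : S^T = S ->
  nearest S G x y <-> G y /\ forall z, G z -> score S x z <= score S x y.
Proof.
move=> Ssym.
have E z : sprod S (x - z) (x - z) = sprod S x x - 2 * score S x z.
  rewrite /score /sprod mulmxBr !dotBl !dotBr (dotC z (S *m x)).
  rewrite -dot_mulmx_sym//; lra.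
by split=> -[Gy ymin]; split=> // z Gz; move: (ymin z Gz); rewrite !E; lra.
Qed.

(** Closed graph of the nearest-point map, with an error [e n] that tends to 0. It serves twice: for
    near-maximizers at a fixed point, and for exact nearest points at moving points. *)
Lemma nearest_limit S G x y (u v : nat -> 'cV[R]_d) (e : nat -> R) :
  S^T = S -> closed G -> (forall n, G (v n)) ->
  (forall n z, G z -> score S (u n) z <= score S (u n) (v n) + e n) ->
  u n @[n --> \oo] --> x -> v n @[n --> \oo] --> y ->
  e n @[n --> \oo] --> 0 -> nearest S G x y.
Proof.
move=> Ssym clG Gv vmax ux vy e0; apply/nearestP => //; split.
  have nG : \forall n \near \oo, G (v n) by apply: filterE => n; exact: Gv.
  exact: (closed_cvg G clG nG y vy).
have score_cvg (a b : nat -> 'cV[R]_d) p q : a n @[n --> \oo] --> p ->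
    b n @[n --> \oo] --> q -> score S (a n) (b n) @[n --> \oo] --> score S p q.
  move=> ap bq; have Sq : S *m b n @[n --> \oo] --> S *m q by exact: mulmx_cvg.
  rewrite /score /sprod; apply: cvgB; first exact: (dot_cvg ap Sq).
  by apply: cvgM; [exact: cvg_cst|exact: (dot_cvg bq Sq)].
move=> z Gz; rewrite -[leRHS]addr0.
have nle : \forall n \near \oo, score S (u n) z <= score S (u n) (v n) + e n.
  by apply: filterE => n; exact: vmax.
exact: (ler_cvg_to (score_cvg _ _ _ _ ux (cvg_cst z))
  (cvgD (score_cvg _ _ _ _ ux vy) e0) nle).
Qed.

Lemma psi_fin_num S G x : G !=set0 -> (psi S G x < +oo)%E ->
  psi S G x \is a fin_num.
Proof.
move=> [y Gy] xlt; rewrite fin_numE; apply/andP; split; last by rewrite lt_eqF.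
apply/eqP => xN; have : [set (score S x w)%:E | w in G] (score S x y)%:E.
  by exists y.
by move=> /ereal_sup_ubound; rewrite [ereal_sup _]xN leeNy_eq.
Qed.

Lemma score_psi S G x y : G y -> (psi S G x < +oo)%E ->
  score S x y <= fine (psi S G x).
Proof.
move=> Gy xlt; rewrite -lee_fin fineK.
  by apply: ereal_sup_ubound; exists y.
by apply: psi_fin_num => //; exists y.
Qed.

Lemma score_psi_adherent S G x e : G !=set0 -> (psi S G x < +oo)%E -> 0 < e ->
  exists2 y, G y & fine (psi S G x) < score S x y + e.
Proof.
move=> G0 xlt e0; have xfin := psi_fin_num G0 xlt.
have [_ [y Gy <-]] := ub_ereal_sup_adherent e0 xfin.
rewrite -[ereal_sup _]/(psi S G x) -(fineK xfin) -EFinB lte_fin => H.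
by exists y => //; rewrite -ltrBlDr.
Qed.

Lemma derivable_approx (V : normedModType R) (f : V -> R) (x v : V) e :
  derivable f x v -> 0 < e ->
  \forall s \near 0^', `|f (s *: v + x) - f x - s * 'D_v f x| <= e * `|s|.
Proof.
move=> fxv e0; have /cvgrPdist_le/(_ e e0) := fxv.
rewrite -[lim _]/('D_v f x) => near_le.
near=> s; have s0 : s != 0 by near: s; exact: nbhs_dnbhs_neq.
have -> : f (s *: v + x) - f x - s * 'D_v f x =
    - (s * ('D_v f x - s^-1 * (f (s *: v + x) - f x))).
  by rewrite mulrBr mulVKf//; ring.
rewrite normrN normrM mulrC ler_wpM2r//.
by near: s.
Unshelve. all: by end_near. Qed.

(** A first-order expansion tested at both [s] and [- s] bounds a slope from above and from
    below. *)
Lemma near0_symmetric (P : R -> Prop) : (\forall s \near 0^', P s) ->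
  exists s, [/\ 0 < s, P s & P (- s)].
Proof.
move=> [r /= r0 rP]; exists (r / 2); have r20 : 0 < r / 2 by rewrite divr_gt0.
have rr : r / 2 < r by rewrite ltr_pdivrMr// ltr_pMr// ltr1n.
split=> //; apply: rP; rewrite /= ?oppr_eq0 ?gt_eqF// sub0r ?opprK ?normrN.
  by rewrite gtr0_norm.
by rewrite gtr0_norm.
Qed.

(** A near-maximizer [z] gives an affine minorant of psi with slope [S *m z] that almost touches psi
    at [x]. Comparing it with the first-order expansion of psi on both sides of [x], along each
    basis vector, shows that its slope is close to the gradient. *)
Lemma approx_nearest S G x e : S^T = S -> G !=set0 ->
  dom_gradient (psi S G) x -> 0 < e ->
  exists z, [/\ G z, forall w, G w -> score S x w <= score S x z + e &
    forall i, `|(S *m z) i 0 - gradient (fine \o psi S G) x i 0| <= e].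
Proof.
move=> Ssym G0 [xint xdiff] e0; set f := fine \o psi S G.
have xdom : (psi S G x < +oo)%E by exact: (nbhs_singleton xint).
have e20 : 0 < e / 2 by rewrite divr_gt0.
have /near0_symmetric[s [s0 Ps Pns]] : \forall s \near 0^',
    forall i : 'I_d, `|f (s *: delta_mx i 0 + x) - f x - s * gradient f x i 0|
      <= e / 2 * `|s| /\ (psi S G (s *: delta_mx i 0 + x)%R < +oo)%E.
  apply: filter_forall => i; apply: filterI.
    rewrite mxE; apply: derivable_approx => //; exact: diff_derivable.
  have cx : (s *: delta_mx i 0 + x) @[s --> (0 : R)^'] --> x.
    rewrite -[X in _ --> X]add0r -(scale0r (delta_mx i 0)).
    apply: cvgD; last exact: cvg_cst.
    by apply: cvgZr_tmp; exact: nbhs_dnbhs.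
  exact: (cx _ xint).
(* The bound by 1 gives near-maximality up to [e]; the bound by [s] keeps the error below [e / 2]
   after division by the increment [s]. The other [e / 2] comes from the expansion. *)
have em0 : 0 < e / 2 * Num.min 1 s by rewrite mulr_gt0// lt_min ltr01 s0.
have [z Gz fz] := score_psi_adherent G0 xdom em0.
have m1 : e / 2 * Num.min 1 s <= e / 2 * 1.
  by rewrite ler_pM2l// ge_min lexx.
have ms : e / 2 * Num.min 1 s <= e / 2 * s.
  by rewrite ler_pM2l// ge_min lexx orbT.
exists z; split=> // [w Gw|i].
  by have := score_psi Gw xdom; rewrite -/f; lra.
have step t : (psi S G (t *: delta_mx i 0 + x)%R < +oo)%E ->
    score S x z + t * (S *m z) i 0 <= f (t *: delta_mx i 0 + x).
  move=> tdom; apply: le_trans (score_psi Gz tdom).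
  by rewrite /score /sprod dotDl dotZl dot_delta; lra.
have [+ /step] := Ps i; have [+ /step] := Pns i.
rewrite [`|- s|]normrN (gtr0_norm s0) !ler_norml -/f.
move=> /andP[_ h1] h2 /andP[_ h3] h4.
rewrite -[fine _]/(f x) in fz.
by apply/andP; split; rewrite -(ler_pM2l s0); lra.
Qed.

(** Near-maximizers [z n] with error 1/(n+1) satisfy that [S *m z n] tends to the gradient; as [S]
    is invertible, [z n] itself converges, and its limit is nearest. *)
Lemma gradient_nearest S G x : S^T = S -> S \in unitmx -> closed G ->
  G !=set0 -> dom_gradient (psi S G) x ->
  nearest S G x (invmx S *m gradient (fine \o psi S G) x).
Proof.
move=> Ssym Sunit clG G0 xdom.
have /choice[z zP] : forall n, exists z, _ :=
  fun n => approx_nearest Ssym G0 xdom (@harmonic_gt0 R n).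
have Gz n : G (z n) by have [] := zP n.
apply: (nearest_limit (u := fun=> x) (v := z) (e := harmonic)) => //.
- by move=> n w Gw; have [_ + _] := zP n; exact.
- exact: cvg_cst.
- have -> : z = fun n => invmx S *m (S *m z n).
    by apply/funext => n; rewrite mulKmx.
  apply: mulmx_cvg; apply: cvg_coord => i k; rewrite ord1.
  apply/cvgrPdist_le => e e0.
  have : \forall n \near \oo, @harmonic R n <= e.
    have /cvgrPdist_le/(_ e e0) := @cvg_harmonic R.
    apply: filterS => n; rewrite sub0r normrN ger0_norm//; exact: harmonic_ge0.
  apply: filterS => n; apply: le_trans.
  by rewrite distrC; have [_ _] := zP n; exact.
- exact: cvg_harmonic.
Qed.

Lemma limiting_gradients_nearest S G x v : S^T = S -> S \in unitmx ->
  closed G -> G !=set0 -> limiting_gradients (psi S G) x v ->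
  nearest S G x (invmx S *m v).
Proof.
move=> Ssym Sunit clG G0 [u [udom ux gv]].
have un n := gradient_nearest Ssym Sunit clG G0 (udom n).
apply: (nearest_limit (u := u) (e := fun=> 0)
  (v := fun n => invmx S *m gradient (fine \o psi S G) (u n))) => //.
- by move=> n; have [] := un n.
- by move=> n z Gz; rewrite addr0; have /nearestP[//|_] := un n; exact.
- exact: mulmx_cvg.
- exact: cvg_cst.
Qed.

(** If all nearest points of [x] have the same [j]-th coordinate, then the limiting gradients lie in
    a closed convex set [H] on which the [j]-th coordinate of [invmx S *m v] is constant, so the
    Clarke subdifferential lies there too. *)
Lemma Sigma_sclarke_nearest S G (j : 'I_d) : S^T = S -> S \in unitmx ->
  closed G -> G !=set0 ->
  Sigma j (sclarke S (psi S G)) `<=` Sigma j (nearest S G).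
Proof.
move=> Ssym Sunit clG G0 x [_ [_ [[v1 v1x <-] [v2 v2x <-] v12]]].
apply: contrapT => xS.
have [c nc] : exists c, forall y, nearest S G x y -> y j 0 = c.
  have [[y0 ny0]|nx] := pselect (exists y, nearest S G x y).
    exists (y0 j 0) => y ny; apply/eqP/negPn/negP => yy0.
    by apply: xS; exists y, y0.
  (* Without nearest points any value of [c] serves. *)
  by exists 0 => y ny; exfalso; apply: nx; exists y.
pose H : set 'cV[R]_d := [set v | (invmx S *m v) j 0 = c].
have convexH : @convex_set R 'cV[R]_d H.
  move=> v w l; rewrite !inE /H /= => vc wc.
  rewrite /conv/= mulmxDr -!scalemxAr !mxE/=.
  rewrite mxE in vc; rewrite mxE in wc; rewrite vc wc -mulrDl.
  by rewrite /unstable.onem addrCA subrr addr0 mul1r.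
have closedH : closed H.
  have cont : continuous (fun v : 'cV[R]_d => (invmx S *m v) j 0).
    move=> v; have cv : invmx S *m w @[w --> v] --> invmx S *m v.
      exact: (@mulmx_cvg _ _ _ _ _ _ (nbhs v) _ id v cvg_id).
    exact: (cvg_mx_entry cv).
  have -> : H = (fun v : 'cV[R]_d => (invmx S *m v) j 0) @^-1` [set c] by [].
  by apply: closed_comp => [v _|]; [exact: cont|exact: closed_eq].
have subH v : clarke (psi S G) x v -> H v.
  move=> [_ cv]; apply: closedH; apply: closure_subset cv.
  apply: smallest_sub => // w /limiting_gradients_nearest nw.
  by apply: nc; exact: nw.
by move: v12; rewrite (subH _ v1x) (subH _ v2x) eqxx.
Qed.
End Nearest.

(** * Directional derivatives *)

Section Derivatives.
Context {R : realType}.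

Lemma is_derive_affine (V : normedModType R) (f : V -> R) (x v : V) D :
  (forall s, f (s *: v + x) = f x + s * D) -> is_derive x v f D.
Proof.
move=> fE.
have cv : s^-1 *: ((f \o shift x) (s *: v) - f x) @[s --> 0^'] --> D.
  apply/cvgrPdist_le => e e0; near=> s.
  have s0 : s != 0 by near: s; exact: nbhs_dnbhs_neq.
  by rewrite /= fE addrAC subrr add0r [_ *: _]mulKf// subrr normr0 ltW.
by split; [apply/cvg_ex; exists D|exact: cvg_lim cv].
Unshelve. all: by end_near. Qed.

(** The two difference quotients are the same function of [s]. It is applied to the linear map
    [row' j]. *)
Lemma is_derive_linear_comp (V W : normedModType R) (L : {linear V -> W})
    (f : W -> R) x v :
  derivable f (L x) (L v) -> is_derive x v (f \o L) ('D_(L v) f (L x)).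
Proof.
move=> df.
have E : (fun s => s^-1 *: (((f \o L) \o shift x) (s *: v) - (f \o L) x)) =
    (fun s => s^-1 *: ((f \o shift (L x)) (s *: L v) - f (L x))).
  by apply/funext => s /=; rewrite linearP.
by split; rewrite /derivable /derive E.
Qed.

Lemma derive_at_min (V : normedModType R) (f : V -> R) (x v : V) :
  derivable f x v -> (forall y, f x <= f y) -> 'D_v f x = 0.
Proof.
move=> df fmin; apply/eqP; rewrite -normr_le0; apply/ler_addgt0Pl => e e0.
have /near0_symmetric[s [s0]] := derivable_approx df e0.
have := fmin (s *: v + x); have := fmin (- s *: v + x).
rewrite addr0 [`|- s|]normrN (gtr0_norm s0) !ler_norml => h1 h2.
move=> /andP[_ h3] /andP[_ h4].
by apply/andP; split; rewrite -(ler_pM2l s0); lra.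
Qed.
End Derivatives.

(** * Linear growth bounds *)

Section Growth.
Context {R : realType} {n : nat}.
Implicit Types u y : 'cV[R]_n.

Lemma abs_coord_le_enorm u i : `|u i 0| <= enorm u.
Proof.
rewrite /enorm -sqrtr_sqr ler_wsqrtr// /dot (bigD1 i)//= -expr2 lerDl.
by apply: sumr_ge0 => k _; rewrite -expr2 sqr_ge0.
Qed.

Lemma enorm_ge0 u : 0 <= enorm u.
Proof. exact: sqrtr_ge0. Qed.

Lemma abs_dot_le M y u : (forall i, `|y i 0| <= M) ->
  `|dot y u| <= n%:R * M * enorm u.
Proof.
move=> yM; apply: le_trans (ler_norm_sum _ _ _) _.
have -> : n%:R * M * enorm u = \sum_(i < n) M * enorm u.
  by rewrite sumr_const card_ord -mulrA mulr_natl.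
apply: ler_sum => i _.
by rewrite normrM ler_pM// ?normr_ge0// abs_coord_le_enorm.
Qed.

Lemma linear_growthW (f : 'cV[R]_n -> R) A B : 0 <= A -> 0 <= B ->
  (forall u, `|f u| <= A + B * enorm u) -> linear_growth f.
Proof.
move=> A0 B0 fAB; exists (A + B + 1); split=> [|u]; first by lra.
by apply: le_trans (fAB u) _; have := enorm_ge0 u; nra.
Qed.
End Growth.

(** * Splitting a vector into its [j]-th coordinate and the rest *)

Section Insertion.
Context {R : realType} {d : nat} (j : 'I_d).
Implicit Types (t : R) (u : 'cV[R]_d.-1) (x y : 'cV[R]_d).

Definition ins t u : 'cV[R]_d :=
  \col_i (if unlift j i is Some k then u k 0 else t).

Lemma ins_row' x : ins (x j 0) (row' j x) = x.
Proof.
apply/matrixP => i k; rewrite ord1 mxE.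
by case: unliftP => [l ->|->]; rewrite ?mxE.
Qed.

Lemma dot_ins y t u : dot y (ins t u) = y j 0 * t + dot (row' j y) u.
Proof.
rewrite /dot (bigD1_ord j)//= mxE unlift_none; congr (_ + _).
by apply: eq_bigr => i _; rewrite !mxE liftK.
Qed.

Lemma dot_row' y x : dot y x = y j 0 * x j 0 + dot (row' j y) (row' j x).
Proof. by rewrite -{1}(ins_row' x) dot_ins. Qed.
End Insertion.

(** * The crossing graph of two convex functions as a zero set *)

Section Crossing.
Context {R : realType} {d : nat} (j : 'I_d).
(** The functions enter only through bounded selections [Y1], [Y2] of their subgradients, which will
    be maximizers over C1 and C2. *)
Context (phi1 phi2 : 'cV[R]_d -> R) (Y1 Y2 : 'cV[R]_d -> 'cV[R]_d) (a b M : R).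
Context (ab : a < b).
Context (sub1 : forall p q, phi1 p + dot (Y1 p) (q - p) <= phi1 q).
Context (sub2 : forall p q, phi2 p + dot (Y2 p) (q - p) <= phi2 q).
Context (Y1a : forall p, Y1 p j 0 <= a) (Y2b : forall p, b <= Y2 p j 0).
Context (Y1M : forall p i, `|Y1 p i 0| <= M).
Context (Y2M : forall p i, `|Y2 p i 0| <= M).

Let e1 (t : R) (u : 'cV[R]_d.-1) := phi1 (ins j t u).
Let e2 (t : R) (u : 'cV[R]_d.-1) := phi2 (ins j t u).

Lemma sub_ins (phi : 'cV[R]_d -> R) (Y : 'cV[R]_d -> 'cV[R]_d) t u s v :
  (forall p q, phi p + dot (Y p) (q - p) <= phi q) ->
  phi (ins j t u) + Y (ins j t u) j 0 * (s - t)
    + (dot (row' j (Y (ins j t u))) v - dot (row' j (Y (ins j t u))) u)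
    <= phi (ins j s v).
Proof.
move=> sub; apply: le_trans (sub (ins j t u) (ins j s v)).
by rewrite dotBr !dot_ins; lra.
Qed.

(** The subgradient is taken at the right end [s] here, and at the left end [t] in [phi2_slope], so
    that the bound on its [j]-th coordinate has the useful sign. *)
Lemma phi1_slope t s u : t <= s -> e1 s u <= e1 t u + a * (s - t).
Proof.
move=> ts; have := sub_ins s u t u sub1; have := Y1a (ins j s u).
by rewrite -/(e1 s u) -/(e1 t u); nra.
Qed.

Lemma phi2_slope t s u : t <= s -> e2 t u + b * (s - t) <= e2 s u.
Proof.
move=> ts; have := sub_ins t u s u sub2; have := Y2b (ins j t u).
by rewrite -/(e2 s u) -/(e2 t u); nra.
Qed.

Lemma sub_lipschitz (phi : 'cV[R]_d -> R) (Y : 'cV[R]_d -> 'cV[R]_d) u t s :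
  (forall p q, phi p + dot (Y p) (q - p) <= phi q) ->
  (forall p i, `|Y p i 0| <= M) ->
  `|phi (ins j s u) - phi (ins j t u)| <= M * `|s - t|.
Proof.
move=> sub YM; have := sub_ins t u s u sub; have := sub_ins s u t u sub.
set ys := Y (ins j s u) j 0; set yt := Y (ins j t u) j 0.
have hs : `|ys * (s - t)| <= M * `|s - t| by rewrite normrM ler_wpM2r ?YM.
have ht : `|yt * (s - t)| <= M * `|s - t| by rewrite normrM ler_wpM2r ?YM.
move: hs ht; rewrite !ler_norml => /andP[h1 h2] /andP[h3 h4] h5 h6.
by apply/andP; split; lra.
Qed.

(** The difference [F] grows at rate at least [b - a], so it changes sign within distance [T] of 0;
    the Lipschitz bounds make it continuous. *)
Lemma crossing_exists u : exists t, e1 t u = e2 t u.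
Proof.
pose F t := e2 t u - e1 t u.
have Fslope t s : t <= s -> (b - a) * (s - t) <= F s - F t.
  move=> ts; have := phi1_slope u ts; have := phi2_slope u ts.
  by rewrite /F; lra.
pose T := `|F 0| / (b - a).
have ba : 0 < b - a by rewrite subr_gt0.
have T0 : 0 <= T by rewrite divr_ge0// ltW.
have baT : (b - a) * T = `|F 0| by rewrite mulrC divfK// gt_eqF.
have FT : 0 <= F T.
  have := Fslope 0 T T0; rewrite subr0 baT.
  by have := ler_norm (- F 0); rewrite normrN; lra.
have FNT : F (- T) <= 0.
  have NT0 : - T <= 0 by lra.
  have := Fslope (- T) 0 NT0; rewrite sub0r opprK baT.
  by have := ler_norm (F 0); lra.
have M0 : 0 <= M by apply: le_trans (Y1M 0 j).
have contF : continuous F.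
  move=> t; apply/cvgrPdist_le => e e0.
  have M1 : 0 < 2 * M + 1 by lra.
  near=> s.
  have st : `|t - s| <= e / (2 * M + 1).
    by near: s; apply: cvgr_dist_le; [exact: cvg_id|rewrite divr_gt0].
  rewrite ler_pdivlMr// in st.
  have := sub_lipschitz u s t sub1 Y1M; have := sub_lipschitz u s t sub2 Y2M.
  rewrite -/(e1 s u) -/(e1 t u) -/(e2 s u) -/(e2 t u) /F !ler_norml.
  have := normr_ge0 (t - s).
  by move=> ? /andP[? ?] /andP[? ?]; apply/andP; split; lra.
have NTT : - T <= T by lra.
have [] := @IVT R F (- T) T 0 NTT.
- exact: continuous_subspaceT.
- have FNTT : F (- T) <= F T by lra.
  by rewrite min_l// max_r// FNT FT.
- by move=> t _ /subr0_eq te; exists t; rewrite te.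
Unshelve. all: by end_near. Qed.

Let tau u : R := projT1 (cid (crossing_exists u)).
Let tauE u : e1 (tau u) u = e2 (tau u) u := projT2 (cid (crossing_exists u)).

Lemma crossing_unique u t : e1 t u = e2 t u -> t = tau u.
Proof.
move=> te; have ba : 0 < b - a by rewrite subr_gt0.
have := tauE u; have [tle|tgt] := leP t (tau u).
  have := phi1_slope u tle; have := phi2_slope u tle => *; apply/eqP.
  by rewrite eq_le tle -(ler_pM2l ba); lra.
have tge := ltW tgt.
have := phi1_slope u tge; have := phi2_slope u tge => *; apply/eqP.
by rewrite eq_le tge andbT -(ler_pM2l ba); lra.
Qed.

Let w c u := e1 (tau u) u - c * tau u.

(** At the averaged height [s], both functions are at most the average of their common values at the
    two crossings. It remains to pass from [s] to the true crossing [tau u] without increasing the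
    value. *)
Lemma convex_crossing c u1 u2 l : a <= c -> c <= b -> 0 <= l -> l <= 1 ->
  w c (l *: u1 + (1 - l) *: u2) <= l * w c u1 + (1 - l) * w c u2.
Proof.
move=> ac cb l0 l1; set u := _ + _.
set s := l * tau u1 + (1 - l) * tau u2.
have l1' : 0 <= 1 - l by lra.
(* Convexity follows by averaging the subgradient inequality based at the intermediate point. *)
have conv (phi : 'cV[R]_d -> R) (Y : 'cV[R]_d -> 'cV[R]_d) :
    (forall p q, phi p + dot (Y p) (q - p) <= phi q) ->
    phi (ins j s u) <=
      l * phi (ins j (tau u1) u1) + (1 - l) * phi (ins j (tau u2) u2).
  move=> sub.
  have := ler_wpM2l l0 (sub_ins s u (tau u1) u1 sub).
  have := ler_wpM2l l1' (sub_ins s u (tau u2) u2 sub).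
  by rewrite [dot _ u]dotDr !dotZr /s; lra.
have := conv _ _ sub2; have := conv _ _ sub1.
rewrite -/(e1 (tau u1) u1) -/(e1 (tau u2) u2) -/(e1 s u).
rewrite -/(e2 (tau u1) u1) -/(e2 (tau u2) u2) -/(e2 s u) -!tauE /w => h1 h2.
have ws : l * (e1 (tau u1) u1 - c * tau u1)
    + (1 - l) * (e1 (tau u2) u2 - c * tau u2) =
  l * e1 (tau u1) u1 + (1 - l) * e1 (tau u2) u2 - c * s by rewrite /s; ring.
(* Below the crossing use phi1 - c t, nonincreasing in t as a <= c; above it use phi2 - c t,
   nondecreasing as c <= b. *)
rewrite ws; have [st|/ltW ts] := leP s (tau u).
  by have := phi1_slope u st; nra.
by have := phi2_slope u ts; rewrite -tauE; nra.
Qed.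

Lemma phi_ins_growth (phi : 'cV[R]_d -> R) (Y : 'cV[R]_d -> 'cV[R]_d) t u :
  (forall p q, phi p + dot (Y p) (q - p) <= phi q) ->
  (forall p i, `|Y p i 0| <= M) ->
  `|phi (ins j t u)| <= `|phi (ins j 0 0)| + M * `|t| + d.-1%:R * M * enorm u.
Proof.
move=> sub YM; have := sub_ins 0 0 t u sub; have := sub_ins t u 0 0 sub.
set p := ins j t u; set o := ins j 0 0.
have tM q : `|Y q j 0 * t| <= M * `|t| by rewrite normrM ler_wpM2r ?YM.
have uM q : `|dot (row' j (Y q)) u| <= d.-1%:R * M * enorm u.
  by apply: abs_dot_le => i; rewrite mxE YM.
have := tM p; have := tM o; have := uM p; have := uM o.
have := ler_norm (phi o); have := ler_norm (- phi o).
rewrite !dot0r normrN !ler_norml.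
move=> ? ? /andP[? ?] /andP[? ?] /andP[? ?] /andP[? ?] ? ?.
by apply/andP; split; lra.
Qed.

Lemma linear_growth_crossing c : linear_growth (w c).
Proof.
have M0 : 0 <= M by apply: le_trans (Y1M 0 j).
have ba : 0 < b - a by rewrite subr_gt0.
pose P := `|phi1 (ins j 0 0)| + `|phi2 (ins j 0 0)|.
pose Q := d.-1%:R * M.
have P0 : 0 <= P by rewrite addr_ge0.
have Q0 : 0 <= Q by rewrite mulr_ge0.
pose r := (b - a)^-1.
have r0 : 0 < r by rewrite invr_gt0.
(* The gap at t = 0 closes at rate at least [b - a], which bounds [tau u] by a quantity of linear
   growth. *)
have tauG u : `|tau u| <= (2 * r) * (P + Q * enorm u).
  have ab0 : (b - a) * `|tau u| <= `|e2 0 u - e1 0 u|.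
    have := tauE u; have [t0|/ltW t0] := leP 0 (tau u).
      have := phi1_slope u t0; have := phi2_slope u t0.
      by have := ler_norm (- (e2 0 u - e1 0 u)); rewrite normrN (ger0_norm t0); lra.
    have := phi1_slope u t0; have := phi2_slope u t0.
    by have := ler_norm (e2 0 u - e1 0 u); rewrite (ler0_norm t0); lra.
  have e12 : `|e2 0 u - e1 0 u| <= 2 * (P + Q * enorm u).
    have := phi_ins_growth 0 u sub1 Y1M; have := phi_ins_growth 0 u sub2 Y2M.
    rewrite -/(e1 0 u) -/(e2 0 u) normr0 mulr0 -/Q.
    have := ler_normB (e2 0 u) (e1 0 u).
    have := normr_ge0 (phi1 (ins j 0 0)); have := normr_ge0 (phi2 (ins j 0 0)).
    by rewrite /P; lra.
  rewrite -(ler_pM2l ba); apply: le_trans ab0 _; apply: le_trans e12 _.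
  by rewrite !mulrA [_ * 2]mulrC -!mulrA (mulrA _ r) divff ?gt_eqF// mul1r.
pose k := (M + `|c|) * (2 * r).
have k0 : 0 <= k by rewrite !mulr_ge0 ?addr_ge0// ltW.
apply: (@linear_growthW _ _ _ (P + k * P) (Q + k * Q)).
- by rewrite addr_ge0// mulr_ge0.
- by rewrite addr_ge0// mulr_ge0.
move=> u; rewrite /w; apply: le_trans (ler_normB _ _) _.
have := phi_ins_growth (tau u) u sub1 Y1M.
rewrite -/(e1 (tau u) u) normrM -/Q.
have c0 : 0 <= M + `|c| by rewrite addr_ge0.
have := ler_wpM2l c0 (tauG u); have := normr_ge0 (phi2 (ins j 0 0)).
by rewrite /P /k; lra.
Qed.

Let g1 u := (b - a)^-1 * w b u.
Let g2 u := (b - a)^-1 * w a u.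

Lemma convex_linear_growth_scale c : a <= c -> c <= b ->
  convex_function setT (fun u => (b - a)^-1 * w c u) /\
  linear_growth (fun u => (b - a)^-1 * w c u).
Proof.
move=> ac cb; have r0 : 0 < (b - a)^-1 by rewrite invr_gt0 subr_gt0.
split.
  move=> l u1 u2 _ _; rewrite convRE.
  have l0 : 0 <= l%:num by [].
  have l1 : l%:num <= 1 by [].
  apply: le_trans (ler_wpM2l (ltW r0) (convex_crossing u1 u2 ac cb l0 l1)) _.
  set r := (b - a)^-1; set w1 := w c u1; set w2 := w c u2.
  by rewrite le_eqVlt; apply/orP; left; apply/eqP; rewrite /unstable.onem; ring.
have [K [K0 wK]] := linear_growth_crossing c.
exists ((b - a)^-1 * K); split; first exact: mulr_gt0.
by move=> u; rewrite normrM gtr0_norm// -mulrA ler_pM2l.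
Qed.

Lemma tauE_diff u : tau u = g2 u - g1 u.
Proof.
rewrite /g1 /g2 /w; have ba : b - a != 0 by rewrite gt_eqF// subr_gt0.
by field.
Qed.

(** Stationarity at [u], written once for phi1 and once for phi2, gives two linear relations whose
    difference determines the derivative of tau. *)
Lemma gradient_crossing x :
  differentiable g1 (row' j x) -> differentiable g2 (row' j x) ->
  let y := Y2 (ins j (tau (row' j x)) (row' j x))
    - Y1 (ins j (tau (row' j x)) (row' j x)) in
  gradient (fun x => x j 0 + g1 (row' j x) - g2 (row' j x)) x
    = (y j 0)^-1 *: y.
Proof.
set u := row' j x; move=> dg1 dg2.
set p := ins j (tau u) u; set y := Y2 p - Y1 p => /=.
have y0 : 0 < y j 0.
  by rewrite !mxE subr_gt0 (le_lt_trans (Y1a p))// (lt_le_trans ab).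
have ba : b - a != 0 by rewrite gt_eqF// subr_gt0.
have stat (phi : 'cV[R]_d -> R) (Y : 'cV[R]_d -> 'cV[R]_d) v :
    (forall p q, phi p + dot (Y p) (q - p) <= phi q) ->
    (forall u, phi (ins j (tau u) u) = e1 (tau u) u) ->
    (b - a) * 'D_v g2 u + (a - Y p j 0) * ('D_v g2 u - 'D_v g1 u)
      = dot (row' j (Y p)) v.
  move=> sub phiE.
  (* This is phi minus its affine minorant at [p], both restricted to the crossing graph, up to a
     constant; hence it is minimal at [u]. Written with [g1] and [g2], it is differentiable at [u]
     although phi itself need not be. *)
  pose k := (b - a) \*: g2 + (a - Y p j 0) \*: (g2 - g1) - dot (row' j (Y p)).
  have d1 : is_derive u v g1 ('D_v g1 u).
    by apply: derivableP; exact: diff_derivable.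
  have d2 : is_derive u v g2 ('D_v g2 u).
    by apply: derivableP; exact: diff_derivable.
  have d3 : is_derive u v (dot (row' j (Y p))) (dot (row' j (Y p)) v).
    by apply: is_derive_affine => s; rewrite dotDr dotZr addrC.
  have dk : is_derive u v k ((b - a) *: 'D_v g2 u
      + (a - Y p j 0) *: ('D_v g2 u - 'D_v g1 u) - dot (row' j (Y p)) v).
    exact: is_deriveB.
  have kE z : k z = phi (ins j (tau z) z) - Y p j 0 * tau z
      - dot (row' j (Y p)) z.
    rewrite phiE /k /= !fctE /= -tauE_diff /g2 /w.
    by rewrite [_ *: _]mulVKf// /GRing.scale /=; ring.
  have : 'D_v k u = 0.
    apply: derive_at_min; first by case: dk.
    move=> z; rewrite !kE; have := sub_ins (tau u) u (tau z) z sub.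
    by rewrite -/p; lra.
  by case: dk => _ -> /eqP; rewrite subr_eq0 => /eqP.
apply/colP => i; rewrite mxE [RHS]mxE.
set v := row' j (delta_mx i 0 : 'cV[R]_d).
have h1 := stat _ _ v sub1 (fun=> erefl).
have h2 := stat _ _ v sub2 (fun z => esym (tauE z)).
have der : is_derive x (delta_mx i 0 : 'cV[R]_d)
    (fun x => x j 0 + g1 (row' j x) - g2 (row' j x))
    ((delta_mx i 0 : 'cV[R]_d) j 0 + 'D_v g1 u - 'D_v g2 u).
  have dr (g : 'cV[R]_d.-1 -> R) : differentiable g u ->
      is_derive x (delta_mx i 0 : 'cV[R]_d) (g \o row' j) ('D_v g u).
    move=> dg; apply: is_derive_linear_comp.
    exact: diff_derivable.
  have dj : is_derive x (delta_mx i 0 : 'cV[R]_d) (fun z : 'cV[R]_d => z j 0)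
      ((delta_mx i 0 : 'cV[R]_d) j 0).
    by apply: is_derive_affine => s; rewrite mxE [in LHS]mxE addrC.
  exact: (is_deriveB (is_deriveD dj (dr _ dg1)) (dr _ dg2)).
case: der => _ ->.
have := dot_row' j y (delta_mx i 0); rewrite dotC dot_delta -/v => ->.
have -> : dot (row' j y) v = dot (row' j (Y2 p)) v - dot (row' j (Y1 p)) v.
  by rewrite -dotBl; congr (dot _ v); apply/matrixP => ? ?; rewrite !mxE.
(* The terms in [(b - a) * 'D_v g2 u] cancel, leaving minus [y j 0] times the derivative of tau. *)
rewrite -h1 -h2; move: y0; rewrite /y !mxE => y0.
by field; rewrite gt_eqF.
Qed.

Lemma dc_family_crossing (C1 C2 : set 'cV[R]_d) :
  (forall p, C1 (Y1 p)) -> (forall p, C2 (Y2 p)) ->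
  exists2 h, dc_family j (theta j (minkowski_diff C2 C1)) h &
    forall x, phi1 x = phi2 x -> h x = 0.
Proof.
move=> YC1 YC2.
exists (fun x : 'cV[R]_d => x j 0 + g1 (row' j x) - g2 (row' j x)).
  exists g1, g2; split=> //.
  - by apply: convex_linear_growth_scale => //; exact: ltW.
  - by apply: convex_linear_growth_scale => //; exact: ltW.
  move=> x dg1 dg2; rewrite gradient_crossing//; set p := ins _ _ _.
  by exists (Y2 p - Y1 p) => //; exists (Y2 p); [|exists (Y1 p)].
move=> x; rewrite -{1 2}(ins_row' j x) => /crossing_unique ->.
by rewrite tauE_diff; ring.
Qed.
End Crossing.

(** * Separated compact pairs and the countable covering *)

Section Covering.
Context {R : realType} {d : nat}.
Implicit Types (S : 'M[R]_d) (x y z : 'cV[R]_d) (G : set 'cV[R]_d) (j : 'I_d).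

Lemma continuous_sprod S : continuous (fun y => sprod S y y).
Proof.
move=> y; have Sy : S *m z @[z --> y] --> S *m y.
  exact: (@mulmx_cvg _ _ _ _ _ _ (nbhs y) _ id y cvg_id).
exact: (@dot_cvg _ _ _ (nbhs y) _ id _ y _ cvg_id Sy).
Qed.

Lemma compact_coord_bounded (C : set 'cV[R]_d) : compact C ->
  exists M, forall y i, C y -> `|y i 0| <= M.
Proof.
move=> cC; have [C0|/set0P/negP/negPn/eqP ->] := pselect (C !=set0); last first.
  by exists 0.
have [//|c _ cmax] := compact_EVT_max (f := fun y => dot y y) C0 cC.
  apply: continuous_subspaceT => y.
  exact: (@dot_cvg _ _ _ (nbhs y) _ id id y y cvg_id cvg_id).
exists (enorm c) => y i Cy; apply: le_trans (abs_coord_le_enorm y i) _.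
by apply: ler_wsqrtr; apply: cmax; rewrite inE.
Qed.

Lemma score_maximizer S (C : set 'cV[R]_d) : C !=set0 -> compact C ->
  exists Y : 'cV[R]_d -> 'cV[R]_d, forall p, C (Y p) /\
    forall y, C y -> dot p y - 2^-1 * sprod S y y
      <= dot p (Y p) - 2^-1 * sprod S (Y p) (Y p).
Proof.
move=> C0 cC; suff /choice[Y YP] : forall p, exists z, C z /\ forall y, C y ->
    dot p y - 2^-1 * sprod S y y <= dot p z - 2^-1 * sprod S z z by exists Y.
move=> p.
have [//|c cC' cmax] :=
    compact_EVT_max (f := fun y => dot p y - 2^-1 * sprod S y y) C0 cC.
  apply: continuous_subspaceT => y.
  have cy : dot p z @[z --> y] --> dot p y.
    exact: (@dot_cvg _ _ _ (nbhs y) _ (fun=> p) id p y (cvg_cst p) cvg_id).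
  have cS : 2^-1 * sprod S z z @[z --> y] --> 2^-1 * sprod S y y.
    exact: (cvgM (cvg_cst _) (@continuous_sprod S y)).
  exact: (cvgB cy cS).
rewrite inE in cC'; exists c; split=> // y Cy.
by apply: cmax; rewrite inE.
Qed.

Lemma dc_family_separated S G j (C1 C2 : set 'cV[R]_d) (a b : R) :
  S^T = S -> a < b -> C1 !=set0 -> C2 !=set0 -> compact C1 -> compact C2 ->
  C1 `<=` G -> C2 `<=` G ->
  (forall y, C1 y -> y j 0 <= a) -> (forall y, C2 y -> b <= y j 0) ->
  exists2 h, dc_family j (theta j (minkowski_diff C2 C1)) h &
    forall x y1 y2, C1 y1 -> C2 y2 -> nearest S G x y1 -> nearest S G x y2 ->
      h (S *m x) = 0.
Proof.
move=> Ssym ab C10 C20 cC1 cC2 C1G C2G C1a C2b.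
have [Y1 Y1P] := score_maximizer S C10 cC1.
have [Y2 Y2P] := score_maximizer S C20 cC2.
have [M1 C1M1] := compact_coord_bounded cC1.
have [M2 C2M2] := compact_coord_bounded cC2.
pose phi (Y : 'cV[R]_d -> 'cV[R]_d) p := dot p (Y p) - 2^-1 * sprod S (Y p) (Y p).
have sub C Y : (forall p, C (Y p) /\ forall y, C y ->
      dot p y - 2^-1 * sprod S y y <= phi Y p) ->
    forall p q, phi Y p + dot (Y p) (q - p) <= phi Y q.
  move=> YP p q; have [CYp _] := YP p; have [_ /(_ _ CYp)] := YP q.
  by rewrite /phi dotBr ![dot (Y p) _]dotC; lra.
have Y1a p : Y1 p j 0 <= a by apply: C1a; case: (Y1P p).
have Y2b p : b <= Y2 p j 0 by apply: C2b; case: (Y2P p).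
have Y1M p i : `|Y1 p i 0| <= Num.max M1 M2.
  by rewrite le_max C1M1//; case: (Y1P p).
have Y2M p i : `|Y2 p i 0| <= Num.max M1 M2.
  by rewrite le_max C2M2 ?orbT//; case: (Y2P p).
have [] := dc_family_crossing ab (sub _ _ Y1P) (sub _ _ Y2P) Y1a Y2b Y1M Y2M
  (C1 := C1) (C2 := C2).
- by move=> p; case: (Y1P p).
- by move=> p; case: (Y2P p).
move=> h dch h0; exists h => // x y1 y2 Cy1 Cy2 /nearestP[//|Gy1 max1].
move=> /nearestP[//|Gy2 max2]; apply: h0.
(* A maximizer over [G] that lies in [C], a subset of [G], is also a maximizer over [C], so both
   maxima at [S *m x] equal the maximum over [G]. *)
have phiE C Y y : (forall p, C (Y p) /\ forall y, C y ->
      dot p y - 2^-1 * sprod S y y <= phi Y p) -> C `<=` G -> C y ->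
    (forall z, G z -> score S x z <= score S x y) ->
    phi Y (S *m x) = score S x y.
  move=> YP CG Cy ymax; have scoreE z : score S x z =
      dot (S *m x) z - 2^-1 * sprod S z z.
    by rewrite /score {1}/sprod dot_mulmx_sym.
  have [CY /(_ _ Cy)] := YP (S *m x); rewrite -scoreE => le1.
  apply/eqP; rewrite eq_le le1 andbT /phi -scoreE.
  by apply: ymax; exact: CG.
rewrite (phiE _ _ _ Y1P C1G Cy1 max1) (phiE _ _ _ Y2P C2G Cy2 max2).
by apply/eqP; rewrite eq_le max1// max2.
Qed.

Lemma compact_minkowski_diff (A B : set 'cV[R]_d) :
  compact A -> compact B -> compact (minkowski_diff A B).
Proof.
move=> cA cB.
have -> : minkowski_diff A B = (fun p => p.1 - p.2) @` (A `*` B).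
  apply/seteqP; split=> [_ [x Ax [y By <-]]|_ [[x y] [/= Ax By] <-]].
    by exists (x, y).
  by exists x => //; exists y.
apply: continuous_compact; last exact: compact_setX.
by apply: continuous_subspaceT => p; apply: cvgB; [exact: cvg_fst|exact: cvg_snd].
Qed.

(** Rational centres and radii 1/(k+1) keep the family countable; closed cubes keep their traces on
    [G] compact. *)
Definition box (q : 'cV[rat]_d) (k : nat) : set 'cV[R]_d :=
  [set y | forall i, `|y i 0 - ratr (q i 0)| <= k.+1%:R^-1].

Lemma compact_box G q k : closed G -> compact (G `&` box q k).
Proof.
move=> clG; rewrite setIC; apply: compact_closedI => //.
pose A (i : 'I_d) : set R :=
  `[ratr (q i 0) - k.+1%:R^-1, ratr (q i 0) + k.+1%:R^-1]%classic.
have cA : compact [set v : 'rV[R]_d | forall i, A i (v ord0 i)].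
  by apply: rV_compact => i; exact: segment_compact.
have -> : box q k = trmx @` [set v : 'rV[R]_d | forall i, A i (v ord0 i)].
  have AE (y : R) i : A i y = (`|y - ratr (q i 0)| <= k.+1%:R^-1) :> Prop.
    by rewrite /A /= in_itv /= ler_distl.
  apply/seteqP; split=> [y yq|_ [v vA <-] i].
    by exists y^T; rewrite ?trmxK// => i; rewrite AE mxE; exact: yq.
  by have := vA i; rewrite AE mxE.
apply: continuous_compact cA; apply: continuous_subspaceT => v.
apply: (@cvg_coord R d 1 _ (nbhs v) _ trmx) => i l.
under eq_fun do rewrite mxE.
by rewrite mxE; exact: coord_continuous.
Qed.

Definition separated G j (eps : R) (C : set 'cV[R]_d * set 'cV[R]_d) : Prop :=
  exists a b, [/\ a < b, [/\ C.1 !=set0, compact C.1 & C.1 `<=` G],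
    [/\ C.2 !=set0, compact C.2 & C.2 `<=` G],
    (forall y, C.1 y -> y j 0 <= a) /\ (forall y, C.2 y -> b <= y j 0) &
    (diam (theta j (minkowski_diff C.2 C.1)) < eps%:E)%E].

Definition box_pair G (c : 'cV[rat]_d * 'cV[rat]_d * nat) :
    set 'cV[R]_d * set 'cV[R]_d :=
  (G `&` box c.1.1 c.2, G `&` box c.1.2 c.2).

Lemma box_approx y k : exists q, box q k y.
Proof.
have k0 : 0 < (k.+1%:R : R)^-1 by rewrite invr_gt0.
have /choice[q qP] : forall i, exists q : rat,
    ratr q \in `]y i 0 - k.+1%:R^-1, y i 0 + k.+1%:R^-1[.
  by move=> i; apply: rat_in_itvoo; rewrite ltrD2l gtrN.
exists (\col_i q i) => i; rewrite mxE.
have := qP i; rewrite in_itv/= => /andP[/ltW h1 /ltW h2].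
by rewrite ler_distlC h1 h2.
Qed.

(** The normalized difference [Th] is continuous at [(y1, y2)], where its denominator is nonzero, so
    small enough boxes around the two points have a normalized difference set of small diameter. *)
Lemma separated_box_pair G j eps y1 y2 : closed G -> 0 < eps -> G y1 -> G y2 ->
  y1 j 0 < y2 j 0 -> exists c, [/\ separated G j eps (box_pair G c),
    (box_pair G c).1 y1 & (box_pair G c).2 y2].
Proof.
move=> clG e0 Gy1 Gy2 y12.
pose D (p : 'cV[R]_d * 'cV[R]_d) := p.2 - p.1.
pose Th p := (D p j 0)^-1 *: D p.
have Dc : D p @[p --> (y1, y2)] --> D (y1, y2).
  by apply: cvgB; [exact: cvg_snd|exact: cvg_fst].
have Thc : Th p @[p --> (y1, y2)] --> Th (y1, y2).
  apply: cvgZ => //; apply: cvgV; last exact: (cvg_mx_entry Dc).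
  by rewrite /D /= !mxE gt_eqF// subr_gt0.
pose Q p := dot (Th p - Th (y1, y2)) (Th p - Th (y1, y2)).
have Qc : Q p @[p --> (y1, y2)] --> 0.
  have -> : 0 = Q (y1, y2).
    by rewrite /Q subrr dot0r.
  have Tc : Th p - Th (y1, y2) @[p --> (y1, y2)] --> Th (y1, y2) - Th (y1, y2).
    by apply: cvgB => //; exact: cvg_cst.
  exact: dot_cvg.
(* Moving each end inwards by a third of the gap leaves a gap of [del] between the two bounds. *)
pose del := (y2 j 0 - y1 j 0) / 3.
have del0 : 0 < del by rewrite divr_gt0// subr_gt0.
have e4 : 0 < (eps / 4) ^+ 2 by rewrite exprn_gt0// divr_gt0.
have /cvgrPdist_le/(_ _ e4) /nbhs_ballP[r /= r0 rQ] := Qc.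
have m0 : 0 < Num.min r del by rewrite lt_min r0.
(* Two points of one box differ by at most 2/(k+1) in each coordinate. *)
have [k kr] : exists k : nat, 2 * k.+1%:R^-1 < Num.min r del.
  have m20 : 0 < Num.min r del / 2 by rewrite divr_gt0.
  have [k _ /(_ k (leqnn k))] := near_infty_natSinv_lt (PosNum m20).
  by exists k; rewrite mulrC -ltr_pdivlMr.
have [q1 y1q] := box_approx y1 k; have [q2 y2q] := box_approx y2 k.
have near (q : 'cV[rat]_d) y z i : box q k y -> box q k z ->
    `|y i 0 - z i 0| < Num.min r del.
  move=> /(_ i) yq /(_ i) zq; apply: le_lt_trans kr.
  move: (k.+1%:R^-1 : R) yq zq => e; rewrite !ler_norml.
  by move=> /andP[? ?] /andP[? ?]; apply/andP; split; lra.
exists (q1, q2, k); split=> //.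
exists (y1 j 0 + del), (y2 j 0 - del); split.
- by rewrite /del; lra.
- by split; [exists y1|exact: compact_box|exact: subIsetl].
- by split; [exists y2|exact: compact_box|exact: subIsetl].
- split=> y [_ yq] /=.
    have := near _ _ _ j y1q yq; rewrite lt_min ltr_norml => /andP[_].
    by rewrite ltr_norml => /andP[? ?]; lra.
  have := near _ _ _ j y2q yq; rewrite lt_min ltr_norml => /andP[_].
  by rewrite ltr_norml => /andP[? ?]; lra.
(* The supremum needs a bound strictly below [eps]. Distances of at most [eps / 4] to the central
   value give squared distances of at most 4 (eps/4)^2 = (eps/2)^2 by [dot_sub_le]. *)
apply: (@le_lt_trans _ _ (eps / 2)%:E); last by rewrite lte_fin; lra.
apply: ge_ereal_sup => _ [_ [_ [z2 [_ z2q] [z1 [_ z1q] <-]] <-]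
  [_ [_ [w2 [_ w2q] [w1 [_ w1q] <-]] <-] <-]].
rewrite lee_fin.
have Qle z w : box q1 k z -> box q2 k w -> Q (z, w) <= (eps / 4) ^+ 2.
  move=> zq wq; have : ball (y1, y2) r (z, w).
    split; split=> // i l; rewrite ord1 /ball /=.
      by have := near _ _ _ i y1q zq; rewrite lt_min => /andP[].
    by have := near _ _ _ i y2q wq; rewrite lt_min => /andP[].
  by move=> /rQ /=; rewrite sub0r normrN; apply: le_trans; exact: ler_norm.
have := Qle _ _ z1q z2q; have := Qle _ _ w1q w2q.
rewrite /Q -[(_)^-1 *: (z2 - z1)]/(Th (z1, z2)).
rewrite -[(_)^-1 *: (w2 - w1)]/(Th (w1, w2)).
set u := Th (z1, z2); set v := Th (w1, w2); set o := Th _ => uo vo.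
have -> : eps / 2 = Num.sqrt ((eps / 2) ^+ 2).
  by rewrite sqrtr_sqr gtr0_norm// divr_gt0.
apply: ler_wsqrtr.
have -> : u - v = (u - o) - (v - o) by rewrite opprB addrA subrK.
by apply: le_trans (dot_sub_le _ _) _; lra.
Qed.

Lemma separated_admissible S G j eps C : S^T = S -> separated G j eps C ->
  exists h, admissible j G (minkowski_diff C.2 C.1) h /\
    forall x y1 y2, C.1 y1 -> C.2 y2 -> nearest S G x y1 -> nearest S G x y2 ->
      h (S *m x) = 0.
Proof.
move=> Ssym [a [b [ab [C10 cC1 C1G] [C20 cC2 C2G] [C1a C2b] _]]].
have [h dch h0] := dc_family_separated Ssym ab C10 C20 cC1 cC2 C1G C2G C1a C2b.
exists h; split=> //; split=> //.
- exact: compact_minkowski_diff.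
- by move=> _ [x Cx [y Cy <-]]; exists x; [exact: C2G|exists y => //; exact: C1G].
- move=> _ [x Cx [y Cy <-]]; rewrite !mxE subr_gt0.
  by rewrite (le_lt_trans (C1a _ Cy))// (lt_le_trans ab)// C2b.
Qed.

Lemma nearest_singularities_cover S G j eps : S^T = S -> closed G -> 0 < eps ->
  exists (C : nat -> set 'cV[R]_d) (h : nat -> 'cV[R]_d -> R),
    [/\ forall n, indices j G n -> admissible j G (C n) (h n),
        Sigma j (nearest S G) `<=`
          \bigcup_(n in indices j G) [set x | h n (S *m x) = 0] &
        forall n, indices j G n -> (diam (theta j (C n)) < eps%:E)%E].
Proof.
move=> Ssym clG e0.
have [[y1 [y2 [Gy1 Gy2 y12]]]|noy] := pselect (exists y1 y2,
    [/\ G y1, G y2 & y1 j 0 != y2 j 0]); last first.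
  exists (fun=> set0), (fun _ _ => 0); split=> [n [_ /noy]//| |n [_ /noy]//].
  move=> x [y1 [y2 [[Gy1 _] [Gy2 _] y12]]]; exfalso; apply: noy.
  by exists y1, y2.
(* A default pair, for the integers that do not encode a separated pair: every index must still
   carry an admissible function. *)
have [c0 c0s] : exists c, separated G j eps (box_pair G c).
  have [y12'|y21|/eqP] := ltgtP (y1 j 0) (y2 j 0); last by rewrite (negbTE y12).
    by have [c [? _ _]] := separated_box_pair clG e0 Gy1 Gy2 y12'; exists c.
  by have [c [? _ _]] := separated_box_pair clG e0 Gy2 Gy1 y21; exists c.
(* Codes of box pairs start at 0 and indices at 1, hence [n.-1] here and the successor of [pickle c]
   below. *)
have /choice[P PP] : forall n, exists C, separated G j eps C /\
    forall c, unpickle n.-1 = Some c -> separated G j eps (box_pair G c) ->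
      C = box_pair G c.
  move=> n; case: (unpickle n.-1) => [c|]; last by exists (box_pair G c0).
  have [cs|ncs] := pselect (separated G j eps (box_pair G c)).
    by exists (box_pair G c); split=> // _ [<-].
  by exists (box_pair G c0); split=> // _ [<-] /ncs.
have /choice[h hP] := fun n => separated_admissible Ssym (proj1 (PP n)).
exists (fun n => minkowski_diff (P n).2 (P n).1), h; split.
- by move=> n _; have [] := hP n.
- have cover x z1 z2 : nearest S G x z1 -> nearest S G x z2 ->
      z1 j 0 < z2 j 0 -> exists2 n, indices j G n & h n (S *m x) = 0.
    move=> nz1 nz2 z12; have [Gz1 _] := nz1; have [Gz2 _] := nz2.
    have [c [cs cz1 cz2]] := separated_box_pair clG e0 Gz1 Gz2 z12.
    exists (pickle c).+1; first by split=> //; exists y1, y2.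
    have [_ /(_ x z1 z2)] := hP (pickle c).+1; apply=> //.
      by have [_ /(_ c (pickleK c) cs) ->] := PP (pickle c).+1.
    by have [_ /(_ c (pickleK c) cs) ->] := PP (pickle c).+1.
  move=> x [z1 [z2 [nz1 nz2 z12]]].
  have [z12'|z21|/eqP] := ltgtP (z1 j 0) (z2 j 0).
  + by have [n ? ?] := cover x z1 z2 nz1 nz2 z12'; exists n.
  + by have [n ? ?] := cover x z2 z1 nz2 nz1 z21; exists n.
  + by rewrite (negbTE z12).
- by move=> n _; have [[a [b []]]] := PP n.
Qed.
End Covering.

Unset Implicit Arguments.

Theorem theorem4p5 (R : realType) (d m : nat) (S : 'M[R]_d)
    (G : set 'cV[R]_d) (j : 'I_d)
    (hm : (m <= d)%N) (hS : symmetric_signature m S)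
    (hG : monotone_family S G)
    (hD : interior (edom (psi S G)) !=set0) :
  (exists (C : nat -> set 'cV[R]_d) (h : nat -> 'cV[R]_d -> R),
      [/\ forall n, indices j G n -> admissible j G (C n) (h n),
          Sigma j (sclarke S (psi S G)) `<=` Sigma j (nearest S G) &
          Sigma j (nearest S G) `<=`
            \bigcup_(n in indices j G) [set x | h n (S *m x) = 0]]) /\
  (forall eps : R, 0 < eps ->
    exists (C : nat -> set 'cV[R]_d) (h : nat -> 'cV[R]_d -> R),
      [/\ forall n, indices j G n -> admissible j G (C n) (h n),
          Sigma j (sclarke S (psi S G)) `<=` Sigma j (nearest S G),
          Sigma j (nearest S G) `<=`
            \bigcup_(n in indices j G) [set x | h n (S *m x) = 0] &
          forall n, indices j G n ->
            (diam (theta j (C n)) < eps%:E)%E]).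
Proof.
have [Ssym Sunit _] := hS; have [clG G0 _] := hG.
have sub := Sigma_sclarke_nearest (j := j) Ssym Sunit clG G0.
split=> [|eps e0].
  (* With no constraint on diameters, any positive bound will do, here 1. *)
  have [C [h [adm cov _]]] :=
    nearest_singularities_cover j Ssym clG (@ltr01 R).
  by exists C, h.
have [C [h [adm cov dm]]] := nearest_singularities_cover j Ssym clG e0.
by exists C, h.
Qed.
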